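(* Let $M$ be a matroid of rank $n$, where $n \ge 2$, let $B_1, \dots, B_n$ be pairwise disjoint bases of $M$, and let $\alpha = 3\lceil \log n \rceil$. Suppose $\alpha$-element subsets $S_1 \subseteq B_1, \dots, S_n \subseteq B_n$ are chosen independently, each $S_i$ uniformly at random among the $\alpha$-element subsets of $B_i$. Then, with probability at least $\tfrac12$, the collection $(S_1, \dots, S_n)$ contains a transversal basis, i.e. there is a basis of $M$ containing exactly one element from each of $S_1,\dots,S_n$.
   Context: Here $\log$ denotes the natural logarithm. *)

(* Defs.v *)
From HB Require Import structures.
From mathcomp Require Import all_boot all_order all_algebra.
From mathcomp Require Import reals exp Rstruct.
Set Implicit Arguments. Unset Strict Implicit. Unset Printing Implicit Defensive.
Import Order.TTheory GRing.Theory Num.Theory.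

Record matroid (T : finType) := Matroid {
  indep : {set T} -> bool;
  indep0 : indep set0;
  indep_sub : forall A B : {set T}, A \subset B -> indep B -> indep A;
  indep_exch : forall A B : {set T}, indep A -> indep B -> #|A| < #|B| ->
     exists2 x, x \in B :\: A & indep (x |: A)
}.

Definition is_basis (T : finType) (M : matroid T) (X : {set T}) : bool :=
  indep M X && [forall x, (x \notin X) ==> ~~ indep M (x |: X)].

Definition mrank (T : finType) (M : matroid T) : nat :=
  \max_(A : {set T} | indep M A) #|A|.

Definition alpha (n : nat) : nat :=
  (3 * `|Num.ceil (@ln Rdefinitions.R (n%:R)%R)|)%N.

Definition has_transversal_basis (T : finType) (M : matroid T) (n : nat)
    (S : {ffun 'I_n -> {set T}}) : bool :=
  [exists X : {set T}, is_basis M X && [forall i, #|X :&: S i| == 1%N]].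

(* sample space: tuples with S_i an alpha-subset of B_i (uniform product measure
   = uniform measure on this finite set) *)
Definition sample_space (T : finType) (n : nat) (B : 'I_n -> {set T}) :
    {set {ffun 'I_n -> {set T}}} :=
  [set S : {ffun 'I_n -> {set T}} | [forall i, (S i \subset B i) && (#|S i| == alpha n)]].

(* Main.v *)
Require Import Defs.
From mathcomp Require Import all_boot all_order all_algebra.
From mathcomp Require Import reals Rstruct sequences exp zify ring lra.
Set Implicit Arguments. Unset Strict Implicit. Unset Printing Implicit Defensive.
Import Order.TTheory GRing.Theory Num.Theory.

(** By Rado's theorem, a family [S] without independent transversal has a set [J] of
    [k] indices such that the union of the [S i], [i] in [J], has rank less than [k].
    Fix [J], let [n] be the rank of the matroid and [m = n + 1 - k], and reveal the
    [S i], [i] in [J], one at a time.  If the revealed union has corank [d], the next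
    basis contains [d] elements independent over it, so the new corank is at most the
    number of them missed by [S i].  Counting missed [m]-subsets, the expectation of
    ['C(corank, m)] drops at each step by a factor ['C(n - m, a) / 'C(n, a)], which
    is at most [n `^ (- 3 m / n)] for samples of size [a >= 3 ln n].  Hence the union
    has rank less than [k] with probability at most
    ['C(n, m) * n `^ (- 3 m k / n) <= 1 / (2 n 'C(n, k))], and the union bound over
    the ['C(n, k)] sets [J] of each of the [n] sizes gives [1 / 2]. *)

(** * Counting in finite sets *)

Lemma leq_card_bigcup (I T : finType) (P : pred I) (F : I -> {set T}) :
  #|\bigcup_(i | P i) F i| <= \sum_(i | P i) #|F i|.
Proof.
elim/big_rec2: _ => [|i m A _ leAm]; first by rewrite cards0.
by rewrite (leq_trans (leq_card_setU _ _)) // leq_add2l.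
Qed.

Lemma sum_set_of_card_leq (I : finType) (w : {set I} -> nat) (k b : nat) :
  k <= #|I| -> (forall J : {set I}, #|J| = k -> 'C(#|I|, k) * w J <= b) ->
  \sum_(J : {set I} | #|J| == k) w J <= b.
Proof.
move=> k_leq w_leq; rewrite -(@leq_pmul2l 'C(#|I|, k)) ?bin_gt0 //.
rewrite -[in leqRHS]card_draws -sum_nat_const big_distrr /=.
under [leqRHS]eq_bigl do rewrite inE.
by apply: leq_sum => J /eqP; apply: w_leq.
Qed.

Lemma sum_nonempty_set_leq (I : finType) (w : {set I} -> nat) (b : nat) :
  (forall J : {set I}, J != set0 -> 'C(#|I|, #|J|) * w J <= b) ->
  \sum_(J : {set I} | J != set0) w J <= #|I| * b.
Proof.
move=> w_leq; pose layer (J : {set I}) : 'I_#|I|.+1 := inord #|J|.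
have layerE J (k : 'I_#|I|.+1) : (layer J == k) = (#|J| == k).
  by rewrite -val_eqE /= inordK // ltnS max_card.
rewrite (partition_big layer (fun k : 'I_#|I|.+1 => 0 < k)) /=; last first.
  by move=> J J_neq0; rewrite inordK ?ltnS ?max_card // card_gt0.
have -> : #|I| * b = \sum_(k < #|I|.+1 | 0 < k) b.
  by rewrite big_mkcond big_ord_recl /= add0n sum_nat_const card_ord.
apply: leq_sum => k k_gt0.
rewrite (eq_bigl (fun J : {set I} => #|J| == k)) => [|J].
  apply: sum_set_of_card_leq => [|J cJ]; first by rewrite -ltnS.
  by rewrite -cJ w_leq // -card_gt0 cJ.
by rewrite layerE -card_gt0; case: eqP => [->|]; rewrite ?k_gt0 ?andbF.
Qed.

Section FamilyResampling.
Variables (I T : finType) (F : I -> {set T}).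

Definition ffun_with (f : {ffun I -> T}) i x : {ffun I -> T} :=
  [ffun j => if j == i then x else f j].

Lemma sum_family_resample (g : {ffun I -> T} -> nat) i :
  #|F i| * \sum_(f in family F) g f =
  \sum_(f in family F) \sum_(x in F i) g (ffun_with f i x).
Proof.
pose swap (p : {ffun I -> T} * T) := (ffun_with p.1 i p.2, p.1 i).
have swapK : involutive swap.
  move=> [f x]; rewrite /swap /= ffunE eqxx; congr pair.
  by apply/ffunP => j; rewrite !ffunE; case: eqP => // ->.
rewrite big_distrr /=; under eq_bigr do rewrite -sum_nat_const.
rewrite !pair_big (reindex_inj (inv_inj swapK)) /=.
apply: eq_big => [[f x]|[f x] _] //=.
apply/andP/andP => -[/familyP fF xF]; split=> //; try apply/familyP => j.
- by have := fF j; rewrite ffunE; case: eqP => // ->.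
- by have := fF i; rewrite ffunE eqxx.
- by rewrite ffunE; case: eqP => // ->.
Qed.

End FamilyResampling.

Section SubsetsOfCard.
Variable T : finType.
Implicit Types A D X U : {set T}.

Definition ksubsets X k : {set {set T}} := [set U : {set T} | U \subset X & #|U| == k].

Lemma card_ksubsets X k : #|ksubsets X k| = 'C(#|X|, k).
Proof. exact: cards_draws. Qed.

Lemma card_ksubsetsD X A k :
  #|ksubsets (X :\: A) k| = \sum_(U in ksubsets X k) [disjoint U & A].
Proof.
rewrite -sum1_card -big_mkcondr /=; apply: eq_bigl => U.
by rewrite !inE subsetD andbAC.
Qed.

(* Count the pairs of an [m]-subset of [D] and a disjoint [k]-subset of [X]. *)
Lemma sum_bin_cardsD D X k m : D \subset X ->
  \sum_(U in ksubsets X k) 'C(#|D :\: U|, m) = 'C(#|X| - m, k) * 'C(#|D|, m).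
Proof.
move=> sDX; under eq_bigr do rewrite -card_ksubsets card_ksubsetsD.
rewrite exchange_big /= -[in RHS]card_ksubsets mulnC -sum_nat_const.
apply: eq_bigr => A; rewrite inE => /andP[sAD /eqP cA].
under eq_bigr do rewrite disjoint_sym.
by rewrite -card_ksubsetsD card_ksubsets cardsD (setIidPr (subset_trans sAD sDX)) cA.
Qed.

End SubsetsOfCard.

(** * Rank of a matroid *)

Section Rank.
Variables (T : finType) (M : matroid T).
Implicit Types A B F S X Y : {set T}.

Definition rk A : nat := \max_(X : {set T} | (X \subset A) && indep M X) #|X|.

Lemma leq_card_rk X A : X \subset A -> indep M X -> #|X| <= rk A.
Proof. by move=> sXA iX; apply: (bigop.bigmax_sup X); rewrite ?sXA. Qed.

Lemma rk_setT : rk setT = mrank M.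
Proof. by apply: eq_bigl => X; rewrite subsetT. Qed.

Lemma rkS A B : A \subset B -> rk A <= rk B.
Proof.
move=> sAB; apply/bigop.bigmax_leqP => X /andP[sXA iX].
exact: leq_card_rk (subset_trans sXA sAB) iX.
Qed.

Lemma leq_card_mrank X : indep M X -> #|X| <= mrank M.
Proof. by rewrite -rk_setT; apply: leq_card_rk. Qed.

Lemma rk_leq_card A : rk A <= #|A|.
Proof. by apply/bigop.bigmax_leqP => X /andP[sXA _]; apply: subset_leq_card. Qed.

Lemma indep_card_rk A : exists X, [/\ X \subset A, indep M X & #|X| = rk A].
Proof.
pose P : pred {set T} := fun X => (X \subset A) && indep M X.
have [|X /andP[sXA iX] cX] := @bigop.eq_bigmax_cond _ P (fun X => #|X|).
  by apply/card_gt0P; exists set0; rewrite unfold_in sub0set indep0.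
by exists X.
Qed.

Lemma indep_augment X A : indep M X -> #|X| < rk A ->
  exists2 x, x \in A :\: X & indep M (x |: X).
Proof.
have [Y [sYA iY <-]] := indep_card_rk A => iX /(indep_exch iX iY)[x xYX ixX].
by exists x => //; apply: subsetP xYX; apply: setSD.
Qed.

Lemma indep_extend X A : X \subset A -> indep M X ->
  exists Y, [/\ X \subset Y, Y \subset A, indep M Y & #|Y| = rk A].
Proof.
move=> sXA iX; pose P Y := [&& X \subset Y, Y \subset A & indep M Y].
have PX : P X by rewrite /P subxx sXA.
have [Y /and3P[sXY sYA iY] maxY] := arg_maxnP (fun Y => #|Y|) PX.
exists Y; split=> //; apply/eqP; rewrite eqn_leq leq_card_rk //= leqNgt.
apply/negP => /(indep_augment iY)[x /setDP[xA xY] ixY].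
have /maxY : P (x |: Y) by rewrite /P ixY subUset sub1set xA sYA subsetU ?sXY ?orbT.
by rewrite cardsU1 xY /= ltnn.
Qed.

Lemma rk_submodular A B : rk (A :|: B) + rk (A :&: B) <= rk A + rk B.
Proof.
have [X [sX iX cX]] := indep_card_rk (A :&: B).
have sXU : X \subset A :|: B by rewrite (subset_trans sX) // subIset // subsetUl.
have [Y [sXY sY iY cY]] := indep_extend sXU iX.
have cardIY C : #|Y :&: C| <= rk C.
  by rewrite leq_card_rk ?subsetIr // (indep_sub _ iY) ?subsetIl.
apply: leq_trans (leq_add (cardIY A) (cardIY B)).
rewrite -cardsUI -setIUr (setIidPl sY) cY leq_add2l -cX subset_leq_card //.
by rewrite setIACA setIid subsetI sXY.
Qed.

Lemma is_basisE X : is_basis M X = indep M X && (#|X| == mrank M).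
Proof.
rewrite /is_basis; have [iX /=|//] := boolP (indep M X).
rewrite eqn_leq leq_card_mrank //=; apply/forallP/idP => [maxX|geX x].
  rewrite leqNgt -rk_setT; apply/negP => /(indep_augment iX)[x].
  by rewrite inE => /andP[xX _] ixX; have := maxX x; rewrite xX ixX.
apply/implyP => xX; apply: contraL geX => /leq_card_mrank.
by rewrite cardsU1 xX -ltnNge.
Qed.

Lemma card_basis X : is_basis M X -> #|X| = mrank M.
Proof. by rewrite is_basisE => /andP[_ /eqP]. Qed.

Definition corank A : nat := mrank M - rk A.

(* [D] is the part of a basis of [F :|: B] extending a basis of [F]: it is a basis
   of the contraction of [F]. *)
Lemma basis_corank_subset F B : is_basis M B ->
  exists D : {set T}, [/\ D \subset B, #|D| = corank F &
    forall S, corank (F :|: S) <= #|D :\: S|].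
Proof.
rewrite is_basisE => /andP[iB /eqP cB].
have [X [sXF iX cX]] := indep_card_rk F.
have [Y [sXY sY iY cY]] := indep_extend (subsetUl X B) iX.
have {}cY : #|Y| = mrank M.
  by apply/eqP; rewrite eqn_leq leq_card_mrank // cY -cB leq_card_rk ?subsetUr.
have cD : #|Y :\: X| = corank F by rewrite cardsD (setIidPr sXY) cY cX.
exists (Y :\: X); split=> // [|S]; first by rewrite subDset.
have leq_rkFS : #|X :|: (Y :\: X) :&: S| <= rk (F :|: S).
  rewrite leq_card_rk ?setUSS ?subsetIr // (indep_sub _ iY) // subUset sXY.
  by rewrite subIset // subsetDl.
have disjX : X :&: ((Y :\: X) :&: S) = set0.
  by apply/setP => x; rewrite !inE; case: (x \in X).
have := cardsID S (Y :\: X); move: leq_rkFS.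
by rewrite cardsU disjX cards0 cX cD /corank; lia.
Qed.

Lemma sum_bin_corankU F B k m : is_basis M B ->
  \sum_(U in ksubsets B k) 'C(corank (F :|: U), m) <=
  'C(mrank M - m, k) * 'C(corank F, m).
Proof.
move=> basisB; have [D [sDB <- leD]] := basis_corank_subset F basisB.
rewrite -(card_basis basisB) -sum_bin_cardsD //.
by apply: leq_sum => U _; apply/leq_bin2l/leD.
Qed.

End Rank.

(** * Rado's theorem *)

Section Rado.
Variables (T I : finType) (M : matroid T).
Implicit Types (A : I -> {set T}) (J K : {set I}).

Definition rado_condition A :=
  [forall J : {set I}, #|J| <= rk M (\bigcup_(i in J) A i)].

Definition delete_point A i x : I -> {set T} :=
  fun j => if j == i then A i :\ x else A j.

Lemma bigcup_delete_point A i x J : i \notin J ->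
  \bigcup_(j in J) delete_point A i x j = \bigcup_(j in J) A j.
Proof.
move=> iJ; apply: eq_bigr => j jJ.
by rewrite /delete_point ifN //; apply: contraNneq iJ => <-.
Qed.

Lemma rado_delete_pointPn A i x :
  rado_condition A -> ~~ rado_condition (delete_point A i x) ->
  exists2 J : {set I}, i \notin J &
    rk M (A i :\ x :|: \bigcup_(j in J) A j) <= #|J|.
Proof.
move=> /forallP rA /forallPn[J]; rewrite -ltnNge => ltJ.
have iJ : i \in J.
  by apply: contraLR ltJ => iJ; rewrite bigcup_delete_point // -leqNgt.
exists (J :\ i); first by rewrite setD11.
move: ltJ; rewrite (cardsD1 i) iJ (big_setD1 i) //= bigcup_delete_point ?setD11 //.
by rewrite /delete_point eqxx.
Qed.

(* If both deletions failed, submodularity applied to the two violating unions would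
   contradict the condition for [i |: (J :|: K)] and [J :&: K]. *)
Lemma rado_delete_point A i x y :
  rado_condition A -> x != y ->
  rado_condition (delete_point A i x) || rado_condition (delete_point A i y).
Proof.
move=> rA neq_xy; apply/norP => -[].
move=> /(rado_delete_pointPn rA)[J iJ rkU_leq] /(rado_delete_pointPn rA)[K iK rkV_leq].
move/forallP: rA => rA; move: rkU_leq rkV_leq.
set U := _ :|: \bigcup_(j in J) A j.
set V := _ :|: \bigcup_(j in K) A j.
move=> rkU_leq rkV_leq.
have rk_join_geq : #|i |: (J :|: K)| <= rk M (U :|: V).
  apply: leq_trans (rA _) (rkS _ _); rewrite bigcup_setU big_set1 bigcup_setU.
  rewrite /U /V setUACA; apply: setUSS => //; apply/subsetP => z zA.
  by rewrite !inE zA !andbT; have [->|//] := eqVneq z x; rewrite neq_xy.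
have rk_meet_geq : #|J :&: K| <= rk M (U :&: V).
  apply: leq_trans (rA _) (rkS _ _); apply/bigcupsP => j /setIP[jJ jK].
  by rewrite subsetI !subsetU // (bigcup_sup j) ?orbT.
have := leq_trans (rk_submodular M U V) (leq_add rkU_leq rkV_leq).
have := leq_add rk_join_geq rk_meet_geq.
rewrite cardsU1 inE negb_or iJ iK -(cardsUI J K) => lower upper.
by have := leq_trans lower upper; rewrite !addSn ltnn.
Qed.

Lemma rado_representatives A : rado_condition A ->
  exists2 f : I -> T, forall i, f i \in A i & rado_condition (fun i => [set f i]).
Proof.
have [m] := ubnP (\sum_i #|A i|); elim: m => // m IH in A *.
rewrite ltnS => leAm rA.
have [/forallP card_le1|/forallPn[i]] := boolP [forall i, #|A i| <= 1].
  have /fin_all_exists[f Af] i : exists x, A i = [set x].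
    apply/cards1P; rewrite eqn_leq card_le1 /=.
    have /forallP/(_ [set i]) := rA; rewrite cards1 big_set1 => /leq_trans-> //.
    exact: rk_leq_card.
  exists f => [i|]; first by rewrite Af set11.
  by apply/forallP => J; under eq_bigr do rewrite -Af; apply: (forallP rA).
rewrite -ltnNge => /card_gt1P[x [y [xA yA neq_xy]]].
wlog rAx : x y xA yA neq_xy / rado_condition (delete_point A i x).
  move=> deletable; have /orP[rAx|rAy] := rado_delete_point i rA neq_xy.
    exact: (deletable x y).
  by apply: (deletable y x); rewrite // eq_sym.
have [|f fA rf] := IH _ _ rAx.
  apply: leq_trans leAm; rewrite [ltnRHS](bigD1 i) // [ltnLHS](bigD1 i) //=.
  rewrite /delete_point eqxx (cardsD1 x (A i)) xA add1n addSn ltnS.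
  by rewrite leq_add2l; apply/leq_sum => j ji; rewrite ifN.
exists f => // j; move: (fA j); rewrite /delete_point.
by case: eqP => [->|//]; case/setD1P.
Qed.

Theorem rado_independent_transversal A : rado_condition A ->
  exists f : I -> T, [/\ injective f, forall i, f i \in A i & indep M (f @: setT)].
Proof.
move=> /rado_representatives[f fA /forallP/(_ setT)].
have <- : f @: setT = \bigcup_(i in setT) [set f i].
  by apply/setP => x; apply/imsetP/bigcupP => -[i _ /set1P]; exists i.
rewrite cardsT => leq_I_rk.
have leq_im_I : #|f @: setT| <= #|I| by rewrite -cardsT leq_imset_card.
have [Y [sY iY cY]] := indep_card_rk M (f @: setT).
have imY : Y = f @: setT.
  by apply/eqP; rewrite eqEcard sY cY (leq_trans leq_im_I).
exists f; split; rewrite -?imY //.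
have /imset_injP f_inj : #|f @: setT| == #|[set: I]|.
  by rewrite cardsT eqn_leq leq_im_I (leq_trans leq_I_rk) // rk_leq_card.
by move=> i j /f_inj; apply; rewrite inE.
Qed.

End Rado.

Lemma rado_transversal_basis (T : finType) (M : matroid T) (n : nat)
    (S : {ffun 'I_n -> {set T}}) :
  mrank M = n -> (forall i j, i != j -> [disjoint S i & S j]) ->
  rado_condition M S -> has_transversal_basis M S.
Proof.
move=> rM disjS /rado_independent_transversal[f [f_inj fS indep_f]].
apply/existsP; exists (f @: setT).
rewrite is_basisE indep_f card_imset // cardsT card_ord rM eqxx /=.
apply/forallP => i; apply/cards1P; exists (f i).
apply/setP => x; rewrite !inE; apply/andP/eqP => [[/imsetP[j _ ->] fjS]|->].
  have [->//|ji] := eqVneq j i.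
  by rewrite (disjointFr (disjS _ _ ji) (fS j)) in fjS.
by rewrite imset_f // fS.
Qed.

(** * Estimates on binomial coefficients *)

Lemma ffact_leq_expn (n m : nat) : n ^_ m <= n ^ m.
Proof.
elim: m => // m IHm; rewrite ffactnSr expnSr.
by rewrite leq_mul // leq_subr.
Qed.

Lemma bin_leq_expn (n m : nat) : 'C(n, m) <= n ^ m.
Proof.
rewrite (leq_trans _ (ffact_leq_expn n m)) // -bin_ffact.
by rewrite leq_pmulr ?fact_gt0.
Qed.

Lemma bin_leq_exp2n (n m : nat) : 'C(n, m) <= 2 ^ n.
Proof.
have := subset_leq_card (subsetT [set A : {set 'I_n} | #|A| == m]).
by rewrite card_draws -powersetT card_powerset cardsT card_ord.
Qed.

Lemma bin_expn_ratio_leq (j n a : nat) : j <= n -> 'C(j, a) * n ^ a <= 'C(n, a) * j ^ a.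
Proof.
move=> le_jn; rewrite -(leq_pmul2r (fact_gt0 a)) mulnAC bin_ffact [leqRHS]mulnAC.
rewrite bin_ffact; elim: a => // a IHa.
rewrite !ffactnSr !expnSr mulnACA [leqRHS]mulnACA leq_mul //.
by rewrite !mulnBl [n * j]mulnC leq_sub2l // leq_mul2l le_jn orbT.
Qed.

Section BinomialPowR.
Local Open Scope ring_scope.
Variable R : realType.

Lemma mulrB_expR_le (x y : R) : 0 < x -> (x - y) * expR (y / x) <= x.
Proof.
move=> x_gt0; rewrite -ler_pdivlMr ?expR_gt0 // -expRN.
have := expR_ge1Dx (- (y / x)); rewrite -(ler_pM2l x_gt0); apply: le_trans.
by rewrite le_eqVlt; apply/orP; left; apply/eqP; field; rewrite gt_eqF.
Qed.

Lemma bin_mul_powR_le (n m a : nat) (c : R) : (0 < n)%N -> (m <= n)%N ->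
  c * ln n%:R <= a%:R ->
  'C(n - m, a)%:R * n%:R `^ (c * (m%:R / n%:R)) <= 'C(n, a)%:R.
Proof.
move=> n_gt0 le_mn le_ca; have nR_gt0 : 0 < n%:R :> R by rewrite ltr0n.
have powR_le : n%:R `^ (c * (m%:R / n%:R)) <= expR (m%:R / n%:R) ^+ a :> R.
  rewrite -expRM_natr /powR gt_eqF // ler_expR mulrAC [leRHS]mulrC.
  by rewrite ler_wpM2r // divr_ge0.
rewrite -(ler_pM2r (exprn_gt0 a nR_gt0)).
apply: (@le_trans _ _ ('C(n, a)%:R * ((n - m)%:R * expR (m%:R / n%:R)) ^+ a)).
  rewrite exprMn [leRHS]mulrA [leLHS]mulrAC ler_pM ?powR_ge0 ?mulr_ge0 ?exprn_ge0 //.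
  by rewrite -!natrX -!natrM ler_nat bin_expn_ratio_leq // leq_subr.
rewrite ler_wpM2l // lerXn2r ?nnegrE ?mulr_ge0 ?expR_ge0 //.
by rewrite natrB // mulrB_expR_le.
Qed.

Lemma expn_le_powR (n p q : nat) : (0 < n)%N -> (p * n <= q)%N ->
  (n ^ p)%:R <= n%:R `^ (q%:R / n%:R) :> R.
Proof.
move=> n_gt0 le_pq; rewrite natrX -powR_mulrn // ler_powR ?ler1n //.
by rewrite ler_pdivlMr ?ltr0n // -natrM ler_nat.
Qed.

Lemma bin_mul_bin_le_powR_skewed (n m k : nat) :
  (1 < n)%N -> (0 < m)%N -> (m + k = n.+1)%N -> (2 * n <= 3 * k)%N ->
  ('C(n, m) * 'C(n, k) * (2 * n))%:R <= n%:R `^ ((3 * m * k)%:R / n%:R) :> R.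
Proof.
move=> n_gt1 m_gt0 sum_mk le_nk; have [m_eq1|m_neq1] := eqVneq m 1%N.
  have -> : k = n by lia.
  apply: le_trans (expn_le_powR (p := 3) _ _); rewrite ?m_eq1; [|lia|lia].
  by rewrite ler_nat bin1 binn !expnS expn0; nia.
(* The exponent is at least [2 * m], as [3 * k >= 2 * n]. *)
apply: le_trans (expn_le_powR (p := 2 * m) _ _); [|lia|nia].
have -> : 'C(n, k) = 'C(n, m.-1) by rewrite -bin_sub; [congr 'C(_, _); lia|lia].
have -> : (2 * m = m + m.-1.+1)%N by lia.
rewrite ler_nat expnD expnS.
have double_bin : ('C(n, m) * 2 <= n ^ m)%N.
  apply: leq_trans (ffact_leq_expn n m); rewrite -bin_ffact leq_mul2l.
  by rewrite (@leq_fact 2) ?orbT //; lia.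
have -> : ('C(n, m) * 'C(n, m.-1) * (2 * n) = 'C(n, m) * 2 * (n * 'C(n, m.-1)))%N.
  by ring.
by rewrite leq_mul // leq_mul2l bin_leq_expn orbT.
Qed.

Lemma bin_mul_bin_le_powR_balanced (n m k : nat) :
  (7 < n)%N -> (m + k = n.+1)%N -> (3 * m < 2 * n)%N -> (3 * k < 2 * n)%N ->
  ('C(n, m) * 'C(n, k) * (2 * n))%:R <= n%:R `^ ((3 * m * k)%:R / n%:R) :> R.
Proof.
move=> n_gt7 sum_mk lt_mn lt_kn; have nR_gt0 : 0 < n%:R :> R by rewrite ltr0n; lia.
(* Both binomials are at most [2 ^ n], and [n `^ (2 / 3) >= 4] as [n >= 8]. *)
apply: (@le_trans _ _ ((n ^ 2)%:R * 4 ^+ n)).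
  rewrite -natrX -natrM ler_nat mulnC leq_mul //; first by nia.
  by rewrite (expnMn 2 2 n) leq_mul ?bin_leq_exp2n.
apply: (@le_trans _ _ (n%:R `^ (2%:R + 2 / 3 * n%:R))); last first.
  apply: ler_powR; first by rewrite ler1n; lia.
  rewrite ler_pdivlMr //.
  have : (6 * n + 2 * n * n <= 3 * (3 * m * k))%N by nia.
  by rewrite -(ler_nat R) !natrD !natrM; lra.
rewrite powRD; last by rewrite (gt_eqF nR_gt0) implybT.
rewrite natrX powR_mulrn // ler_wpM2l ?exprn_ge0 //.
rewrite powRrM powR_mulrn ?powR_ge0 // lerXn2r ?nnegrE ?powR_ge0 //.
rewrite -(@ler_pXn2r _ 3) ?nnegrE ?powR_ge0 // -[leRHS]powR_mulrn ?powR_ge0 // -powRrM.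
rewrite (_ : 2 / 3 * 3%:R = 2%:R); last by field.
by rewrite powR_mulrn // -!natrX ler_nat -[(4 ^ 3)%N]/(8 ^ 2)%N leq_exp2r.
Qed.

Lemma bin_mul_bin_le_powR (n m k : nat) :
  (1 < n)%N -> (0 < m)%N -> (0 < k)%N -> (m + k = n.+1)%N ->
  ('C(n, m) * 'C(n, k) * (2 * n))%:R <= n%:R `^ ((3 * m * k)%:R / n%:R) :> R.
Proof.
move=> n_gt1 m_gt0 k_gt0 sum_mk; have [le_nk|lt_kn] := leqP (2 * n) (3 * k).
  exact: bin_mul_bin_le_powR_skewed.
have [le_nm|lt_mn] := leqP (2 * n) (3 * m).
  rewrite [('C(n, m) * 'C(n, k))%N]mulnC (mulnAC 3).
  by apply: bin_mul_bin_le_powR_skewed => //; lia.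
have [n_gt7|n_lt8] := ltnP 7 n; first exact: bin_mul_bin_le_powR_balanced.
have n_cases : (n = 5 \/ n = 6 \/ n = 7)%N by lia.
have m_cases : (m = 3 \/ m = 4)%N by lia.
apply: le_trans (expn_le_powR (p := minn n 6) _ _); [|lia|nia].
have -> : k = (n.+1 - m)%N by lia.
by rewrite ler_nat; case: m_cases n_cases => -> [->|[->|->]]; vm_compute.
Qed.

Lemma bin_mul_expn_leq (n m k a : nat) : (1 < n)%N -> (0 < m)%N -> (0 < k)%N ->
  (m + k = n.+1)%N -> 3 * ln n%:R <= a%:R :> R ->
  ('C(n, m) * 'C(n, k) * (2 * n) * 'C(n - m, a) ^ k <= 'C(n, a) ^ k)%N.
Proof.
move=> n_gt1 m_gt0 k_gt0 sum_mk le_a.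
have n_gt0 : (0 < n)%N by lia.
have le_mn : (m <= n)%N by lia.
rewrite -(ler_nat R) natrM !natrX.
have := bin_mul_powR_le n_gt0 le_mn le_a; set w := _ `^ _ => le_w.
apply: (@le_trans _ _ (w ^+ k * 'C(n - m, a)%:R ^+ k)).
  rewrite ler_wpM2r ?exprn_ge0 // -[leRHS]powR_mulrn ?powR_ge0 // -powRrM.
  rewrite (_ : _ * k%:R = (3 * m * k)%:R / n%:R) ?bin_mul_bin_le_powR //.
  by rewrite !natrM; ring.
by rewrite -exprMn mulrC lerXn2r ?nnegrE ?mulr_ge0 ?powR_ge0.
Qed.

End BinomialPowR.

(** * Random families of subsets of bases *)

Definition ksubset_families (T I : finType) (B : I -> {set T}) k :
    {set {ffun I -> {set T}}} :=
  [set S in family (fun i => ksubsets (B i) k)].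

Section RadoFailure.
Variables (T I : finType) (M : matroid T) (B : I -> {set T}) (a : nat).
Hypothesis basisB : forall i, is_basis M (B i).
Implicit Types (S : {ffun I -> {set T}}) (J : {set I}).

Local Notation n := (mrank M).
Local Notation samples := (ksubset_families B a).

Definition corank_moment m J : nat :=
  \sum_(S in samples) 'C(corank M (\bigcup_(j in J) S j), m).

Lemma corank_momentU1 m J i : i \notin J ->
  'C(n, a) * corank_moment m (i |: J) <= 'C(n - m, a) * corank_moment m J.
Proof.
move=> iJ; rewrite -{1}(card_basis (basisB i)) -card_ksubsets /corank_moment.
rewrite !(eq_bigl _ _ (in_set _)) sum_family_resample big_distrr /=.
apply: leq_sum => S _.
apply: leq_trans (sum_bin_corankU _ a m (basisB i)); apply: leq_sum => U _.
rewrite big_setU1 //= ffunE eqxx setUC.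
rewrite (eq_bigr S) // => j jJ.
by rewrite ffunE ifN //; apply: contraNneq iJ => <-.
Qed.

Lemma corank_moment_leq m J :
  'C(n, a) ^ #|J| * corank_moment m J <=
  'C(n - m, a) ^ #|J| * ('C(n, m) * #|samples|).
Proof.
have [k] := ubnP #|J|; elim: k => // k IHk in J *; rewrite ltnS => leJk.
have [->|/set0Pn[i iJ]] := eqVneq J set0.
  rewrite cards0 !mul1n mulnC -sum_nat_const; apply: leq_sum => S _.
  exact/leq_bin2l/leq_subr.
move: leJk; rewrite -(setD1K iJ); have := setD11 i J; move: (J :\ i) => K /negbT iK.
rewrite cardsU1 iK add1n !expnSr -!mulnA => ltKk.
rewrite (leq_trans (leq_mul (leqnn _) (corank_momentU1 m iK))) //.
by rewrite mulnCA [leqRHS]mulnCA leq_mul2l IHk ?orbT.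
Qed.

Definition rado_violators J : {set {ffun I -> {set T}}} :=
  [set S in samples | rk M (\bigcup_(j in J) S j) < #|J|].

Lemma card_rado_violators_leq_moment J :
  #|rado_violators J| <= corank_moment (n.+1 - #|J|) J.
Proof.
rewrite -sum1_card /corank_moment big_mkcond [leqRHS]big_mkcond /=.
apply: leq_sum => S _; rewrite inE; case: ifP => //= /andP[-> ltJ].
by rewrite bin_gt0 -[corank _ _]subSS leq_sub2l.
Qed.

Lemma ksubset_families_eq0 (i : I) : 'C(n, a) = 0 -> samples = set0.
Proof.
rewrite -(card_basis (basisB i)) -card_ksubsets => /cards0_eq ksubsets0.
apply/setP => S; rewrite !inE; apply/familyP => /(_ i).
by rewrite ksubsets0 inE.
Qed.

Variable R : realType.
Hypothesis card_I_leq : #|I| <= n.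
Hypothesis n_gt1 : 1 < n.
Hypothesis ln_le_a : (3 * ln n%:R <= a%:R :> R)%R.

Lemma card_rado_violators J : J != set0 ->
  2 * n * 'C(n, #|J|) * #|rado_violators J| <= #|samples|.
Proof.
move=> J_neq0; have J_gt0 : 0 < #|J| by rewrite card_gt0.
have leJn : #|J| <= n by rewrite (leq_trans (max_card _)).
have [bin_eq0|bin_pos] := posnP 'C(n, a).
  have /set0Pn[i _] := J_neq0.
  by rewrite /rado_violators (ksubset_families_eq0 i) // setIdE set0I cards0 muln0.
set m := n.+1 - #|J|.
have m_gt0 : 0 < m by rewrite subn_gt0.
have sum_mJ : m + #|J| = n.+1 by rewrite subnK // ltnW.
have ratio := bin_mul_expn_leq n_gt1 m_gt0 J_gt0 sum_mJ ln_le_a.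
have pow_gt0 : 0 < 'C(n, a) ^ #|J| by rewrite expn_gt0 bin_pos.
rewrite -(leq_pmul2l pow_gt0) mulnCA.
apply: leq_trans (leq_mul (leqnn _) (leq_mul (leqnn _) _)) _.
  exact: card_rado_violators_leq_moment.
apply: leq_trans (leq_mul (leqnn _) (corank_moment_leq m J)) _.
rewrite [leqLHS](_ : _ = 'C(n, m) * 'C(n, #|J|) * (2 * n) *
  'C(n - m, a) ^ #|J| * #|samples|); last by ring.
exact: leq_mul.
Qed.

Theorem leq_card_rado_families :
  #|samples| <= 2 * #|[set S in samples | rado_condition M S]|.
Proof.
set good := [set S in _ | _].
have bad_violators :
    samples :\: good \subset \bigcup_(J : {set I} | J != set0) rado_violators J.
  apply/subsetP => S /setDP[SB]; rewrite inE SB /= => /forallPn[J].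
  rewrite -ltnNge => ltJ; apply/bigcupP; exists J; last by rewrite inE SB.
  by rewrite -card_gt0 (leq_ltn_trans _ ltJ).
have union_bound :=
  leq_trans (subset_leq_card bad_violators) (leq_card_bigcup _ _).
suff : 2 * #|samples :\: good| <= #|samples|.
  have /setIidPr goodE : good \subset samples by apply/subsetP => S /setIdP[].
  by have := cardsID good samples; rewrite goodE; lia.
rewrite -(leq_pmul2l (ltnW n_gt1)) mulnCA mulnA.
apply: leq_trans (leq_mul (leqnn _) union_bound) _.
apply: (@leq_trans (#|I| * #|samples|)); last by rewrite leq_mul2r card_I_leq orbT.
rewrite big_distrr; apply: sum_nonempty_set_leq => J J_neq0.
apply: leq_trans (card_rado_violators J_neq0).
by rewrite mulnA ['C(_, _) * _]mulnC leq_mul2r leq_mul2l leq_bin2l ?orbT.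
Qed.

End RadoFailure.

Lemma sample_spaceE (T : finType) n (B : 'I_n -> {set T}) :
  sample_space B = ksubset_families B (alpha n).
Proof.
by apply/setP => S; rewrite !inE; apply: eq_forallb => i; rewrite inE.
Qed.

Lemma ln_le_alpha (n : nat) : (3 * ln n%:R <= (alpha n)%:R :> Rdefinitions.R)%R.
Proof.
rewrite /alpha natrM ler_pM2l // natr_absz.
by rewrite (le_trans (ceil_ge _)) // ler_int ler_norm.
Qed.

Theorem theorem1p3 (T : finType) (M : matroid T) (n : nat) (B : 'I_n -> {set T}) :
  (2 <= n)%N ->
  mrank M = n ->
  (forall i, is_basis M (B i)) ->
  (forall i j, i != j -> [disjoint B i & B j]) ->
  (* Pr[ transversal basis ] >= 1/2 under the uniform distribution *)
  (#|sample_space B| <= 2 * #|[set S in sample_space B | has_transversal_basis M S]|)%N.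
Proof.
move=> n_gt1 rM basisB disjB.
have many_rado : #|sample_space B| <=
    2 * #|[set S in sample_space B | rado_condition M S]|.
  rewrite sample_spaceE (leq_card_rado_families basisB (R := Rdefinitions.R)) ?rM //.
    by rewrite card_ord.
  exact: ln_le_alpha.
apply: leq_trans many_rado _; rewrite leq_mul2l subset_leq_card //.
apply/subsetP => S /setIdP[SB rS]; rewrite inE SB rado_transversal_basis // => i j ij.
move: SB; rewrite inE => /forallP SB.
have [/andP[sSBi _] /andP[sSBj _]] := (SB i, SB j).
exact: disjointWl sSBi (disjointWr sSBj (disjB _ _ ij)).
Qed.
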